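(* Let $a\leqslant b$ be two positive integers, and let $G$ be a (finite, simple) graph of order $n$, where $n\geqslant a+1$, and where $na\equiv 0\pmod{2}$ in the case $a=b$. If $G$ contains no $[a,b]$-factor, then $$e(G)\leqslant \binom{n-1}{2}+a-1,$$ with equality if and only if one of the following holds: (i) $G\cong K_{a-1}\vee (K_{n-a}\cup K_1)$ or $G\cong K_{1,3}$, if $ab=1$ or $ab=2$; (ii) $G\cong K_{a-1}\vee (K_{n-a}\cup K_1)$ or $G\cong K_2\vee \overline{K_3}$, if $a=b=2$; (iii) $G\cong K_{a-1}\vee (K_{n-a}\cup K_1)$, if $b\geqslant 3$.
   Context: For positive integers $a\leqslant b$, an $[a,b]$-factor of a graph $G$ is a spanning subgraph $F$ of $G$ such that $a\leqslant d_F(v)\leqslant b$ for all $v\in V(G)$. $e(G)$ denotes the number of edges. $G\cup H$ is the disjoint union; $G\vee H$ is the join (disjoint union plus all edges between $G$ and $H$); $K_0\vee H=H$. $\overline{K_3}$ is the empty graph on 3 vertices. *)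

(* Defs.v *)
From mathcomp Require Import all_boot.

Set Implicit Arguments.
Unset Strict Implicit.
Unset Printing Implicit Defensive.

Record sgraph (T : finType) := SGraph {
  adj :> rel T;
  adj_sym : symmetric adj;
  adj_irr : irreflexive adj }.

Definition edges (T : finType) (G : sgraph T) : {set {set T}} :=
  [set [set x; y] | x in T, y in T & G x y].

Definition degree (T : finType) (G : sgraph T) (x : T) : nat :=
  #|[set y | G x y]|.

(* A spanning subgraph of G : sgraph T is an F : sgraph T on the same vertex
   type T whose adjacency implies that of G. *)
Definition spanning_subgraph (T : finType) (F G : sgraph T) : Prop :=
  forall x y, F x y -> G x y.

Definition is_factor (a b : nat) (T : finType) (F G : sgraph T) : Prop :=
  spanning_subgraph F G /\ forall v, a <= degree F v <= b.

Definition isomorphic (T U : finType) (G : sgraph T) (H : sgraph U) : Prop :=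
  exists2 f : T -> U, bijective f & forall x y, H (f x) (f y) = G x y.

Lemma neq_sym (T : finType) : symmetric (fun x y : T => x != y).
Proof. by move=> x y; rewrite eq_sym. Qed.

Lemma neq_irr (T : finType) : irreflexive (fun x y : T => x != y).
Proof. by move=> x; rewrite eqxx. Qed.

Definition complete (n : nat) : sgraph 'I_n :=
  SGraph (@neq_sym 'I_n) (@neq_irr 'I_n).

Definition edgeless (n : nat) : sgraph 'I_n :=
  @SGraph 'I_n (fun _ _ => false) (fun _ _ => erefl) (fun _ => erefl).

(* The disjoint union (cross = false) and the join (cross = true) differ only
   in the adjacency between the two summands. *)
Definition sum_adj (cross : bool) (T U : finType) (G : sgraph T)
    (H : sgraph U) : rel (T + U)%type :=
  fun p q => match p, q with
  | inl x, inl y => G x y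
  | inr x, inr y => H x y
  | _, _ => cross
  end.

Lemma sum_adj_sym cross (T U : finType) (G : sgraph T) (H : sgraph U) :
  symmetric (sum_adj cross G H).
Proof. by move=> [x|x] [y|y] //=; apply: adj_sym. Qed.

Lemma sum_adj_irr cross (T U : finType) (G : sgraph T) (H : sgraph U) :
  irreflexive (sum_adj cross G H).
Proof. by move=> [x|x] /=; apply: adj_irr. Qed.

Definition disjoint_union (T U : finType) (G : sgraph T) (H : sgraph U) :
    sgraph (T + U)%type :=
  SGraph (@sum_adj_sym false T U G H) (@sum_adj_irr false T U G H).

Definition join (T U : finType) (G : sgraph T) (H : sgraph U) :
    sgraph (T + U)%type :=
  SGraph (@sum_adj_sym true T U G H) (@sum_adj_irr true T U G H).

Definition complete_bipartite (m n : nat) : sgraph ('I_m + 'I_n)%type :=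
  join (edgeless m) (edgeless n).

(* K_{a-1} \/ (K_{n-a} U K_1) *)
Definition extremal_graph (n a : nat) :
    sgraph ('I_(a - 1) + ('I_(n - a) + 'I_1))%type :=
  join (complete (a - 1)) (disjoint_union (complete (n - a)) (complete 1)).

(* Main.v *)
Require Import Defs.
From mathcomp Require Import all_boot.
From mathcomp Require Import zify.
From Stdlib Require Import Classical_Prop.

Set Implicit Arguments.
Unset Strict Implicit.
Unset Printing Implicit Defensive.

(** Let H be the complement of G, let h(v) be the degree of v in H and
N = n - a. The bound says that H has at least N edges, so assume that it has at
most N. If h(x) >= N for some x, then H is a star with N edges, that is, G is
the extremal graph. Otherwise G has a spanning subgraph of degree a except for
at most one vertex of degree a + 1, unless H is a triangle and n = a + 3 with
a = 1 or a = 2; parity excludes the exceptional vertex when a = b.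

To find the subgraph, consider graphs E with L <= E <= M and degrees at most c,
having as many edges as possible, where either L is empty, M = G, c = a, or
L = H, M = K_n, c = N - 1 and the complement of E is wanted. If two units of
degree are missing, at x and y, then the edges of E between P = N_{M-E}(x) and
Q = N_{M-E}(y) all lie in L, and double counting shows that there are at least
c(|P| + |Q| + 2 - n) of them. If N <= a + 1, then in the second setting this
exceeds the degree sum of H except for the triangle. If N >= a + 2, then in the
first setting it gives h(x) + h(y) >= N - a + 2, and the deficiency at x can be
moved along E to any neighbour of P. Choosing the pair (x, y) with h(y) minimal
and summing h over all vertices reached in this way forces N = a + 2 and H to be
two-regular on N vertices. For a = 1 this is a triangle; for a >= 2 the second
setting applies again, since now the count forces P to contain all N vertices of
positive degree in H although |P| = N - 1. *)

Lemma leq_sum_eq (I : finType) (P : pred I) (f g : I -> nat) :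
  (forall i, P i -> f i <= g i) ->
  \sum_(i | P i) g i <= \sum_(i | P i) f i -> forall i, P i -> f i = g i.
Proof.
move=> le_fg le_sum i Pi; apply/eqP.
have [le_fg_sum eq_fg_sum] := leqif_sum (fun i Pi => leqif_eq (le_fg i Pi)).
have : \sum_(i | P i) f i == \sum_(i | P i) g i by rewrite eqn_leq le_fg_sum.
by rewrite eq_fg_sum => /forall_inP/(_ i Pi).
Qed.

Lemma sum_mem_card (I : finType) (A : {set I}) : \sum_i (i \in A) = #|A|.
Proof. by rewrite -sum1_card [in RHS]big_mkcond. Qed.

Lemma sum_pred1 (I : finType) (j : I) : \sum_i (i == j) = 1.
Proof.
by rewrite -(cards1 j) -sum_mem_card; apply: eq_bigr => i _; rewrite inE.
Qed.

Lemma ex_min_measure (X : Type) (P : X -> Prop) (mu : X -> nat) :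
  (exists x, P x) -> exists2 x, P x & forall y, P y -> mu x <= mu y.
Proof.
case=> x Px; have [d] := ubnP (mu x); elim: d x Px => // d IH x Px lt_d.
have [[y Py lt_yx]|no_y] := classic (exists2 y, P y & mu y < mu x).
  by apply: (IH y Py); lia.
exists x => // y Py; rewrite leqNgt; apply/negP => lt_yx.
by apply: no_y; exists y.
Qed.

Lemma ex_max_measure (X : Type) (P : X -> Prop) (mu : X -> nat) (B : nat) :
  (forall x, P x -> mu x <= B) -> (exists x, P x) ->
  exists2 x, P x & forall y, P y -> mu y <= mu x.
Proof.
move=> le_B /(ex_min_measure (fun x => B - mu x))[x Px min_x].
by exists x => // y Py; have := min_x y Py; have := le_B y Py; lia.
Qed.

Lemma double_bin2 (m : nat) : 2 * 'C(m, 2) = m * m.-1.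
Proof. by rewrite -mul_bin_diag bin1. Qed.

(** * Graphs on a fixed vertex set *)

Section Graphs.
Variable T : finType.
Implicit Types (F G K : sgraph T) (A : {set T}) (u v w x y : T).

Lemma adj_neq G x y : G x y -> x != y.
Proof. by apply: contraTneq => ->; rewrite adj_irr. Qed.

Definition empty_graph : sgraph T :=
  @SGraph T (fun _ _ => false) (fun _ _ => erefl) (fun _ => erefl).

Definition full_graph : sgraph T := SGraph (@neq_sym T) (@neq_irr T).

Lemma sub_full G : spanning_subgraph G full_graph.
Proof. by move=> x y; apply: adj_neq. Qed.

Definition union_adj G K : rel T := fun u v => G u v || K u v.

Lemma union_adj_sym G K : symmetric (union_adj G K).
Proof. by move=> u v; rewrite /union_adj !(adj_sym _ u). Qed.

Lemma union_adj_irr G K : irreflexive (union_adj G K).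
Proof. by move=> u; rewrite /union_adj !adj_irr. Qed.

Definition union_graph G K : sgraph T :=
  SGraph (@union_adj_sym G K) (@union_adj_irr G K).

Definition diff_adj G K : rel T := fun u v => G u v && ~~ K u v.

Lemma diff_adj_sym G K : symmetric (diff_adj G K).
Proof. by move=> u v; rewrite /diff_adj !(adj_sym _ u). Qed.

Lemma diff_adj_irr G K : irreflexive (diff_adj G K).
Proof. by move=> u; rewrite /diff_adj adj_irr. Qed.

Definition diff_graph G K : sgraph T :=
  SGraph (@diff_adj_sym G K) (@diff_adj_irr G K).

Definition compl G : sgraph T := diff_graph full_graph G.

Lemma complE G u v : compl G u v = (u != v) && ~~ G u v.
Proof. by []. Qed.

Definition edge_adj x y : rel T := fun u v =>
  (x != y) && ((u == x) && (v == y) || (u == y) && (v == x)).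

Lemma edge_adj_sym x y : symmetric (edge_adj x y).
Proof. by move=> u v; rewrite /edge_adj orbC ![(u == _) && _]andbC. Qed.

Lemma edge_adj_irr x y : irreflexive (edge_adj x y).
Proof.
move=> u; rewrite /edge_adj; case: eqVneq => //= nxy; apply/negP.
by case/orP=> /andP[/eqP ux /eqP uy]; move: nxy; rewrite -ux -uy eqxx.
Qed.

Definition edge_graph x y : sgraph T :=
  SGraph (@edge_adj_sym x y) (@edge_adj_irr x y).

Lemma edge_graphP x y u v :
  edge_graph x y u v -> u = x /\ v = y \/ u = y /\ v = x.
Proof. by case/andP=> _ /orP[] /andP[/eqP -> /eqP ->]; [left | right]. Qed.

Lemma edge_graph_sub G x y : G x y -> spanning_subgraph (edge_graph x y) G.
Proof. by move=> Gxy u v /edge_graphP[] [-> ->] //; rewrite adj_sym. Qed.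

Lemma sub_complC F G :
  spanning_subgraph F (compl G) -> spanning_subgraph G (compl F).
Proof.
move=> sF u v Guv; rewrite complE (adj_neq Guv) /=.
by apply: contraL Guv => /sF /andP[].
Qed.

Lemma compl_compl_sub G : spanning_subgraph (compl (compl G)) G.
Proof. by move=> u v; rewrite !complE; case: (u != v); case: (G u v). Qed.

Lemma degreeE G x : degree G x = \sum_y G x y.
Proof.
by rewrite /degree -sum_mem_card; apply: eq_bigr => y _; rewrite inE.
Qed.

Lemma degree_gt0P G x : reflect (exists y, G x y) (0 < degree G x).
Proof.
by apply: (iffP card_gt0P) => -[y Gxy]; exists y; rewrite inE in Gxy *.
Qed.

Lemma degree_le G K x : spanning_subgraph G K -> degree G x <= degree K x.
Proof.
by move=> sGK; apply/subset_leq_card/subsetP => y; rewrite !inE => /sGK.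
Qed.

Lemma degree_empty x : degree empty_graph x = 0.
Proof. by rewrite degreeE big1. Qed.

Lemma degree_full x : (degree full_graph x).+1 = #|T|.
Proof.
rewrite -(cardsC [set x]) cards1 add1n; congr _.+1.
by apply: eq_card => y; rewrite !inE eq_sym.
Qed.

Lemma degree_edge x y w : x != y ->
  degree (edge_graph x y) w = (w == x) + (w == y).
Proof.
move=> nxy; rewrite -[in RHS](muln1 (w == x)) -[in RHS](muln1 (w == y)).
rewrite -{1}(sum_pred1 y) -(sum_pred1 x) !big_distrr -big_split degreeE /=.
apply: eq_bigr => v _; rewrite /edge_adj nxy /=.
by have [->|_] := eqVneq w x; rewrite ?(negbTE nxy); do !case: (_ == _).
Qed.

Lemma degree_union G K x : spanning_subgraph K (compl G) ->
  degree (union_graph G K) x = degree G x + degree K x.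
Proof.
move=> disj; rewrite !degreeE -big_split; apply: eq_bigr => y _ /=.
by rewrite /union_adj; case Kxy: (K x y); rewrite ?orbF ?addn0 // orbT;
  have /andP[_ /negbTE ->] := disj _ _ Kxy.
Qed.

Lemma degree_diff G K x : spanning_subgraph K G ->
  degree (diff_graph G K) x + degree K x = degree G x.
Proof.
move=> sKG; rewrite !degreeE -big_split; apply: eq_bigr => y _ /=.
rewrite /diff_adj; case Kxy: (K x y); first by rewrite (sKG _ _ Kxy).
by rewrite andbT addn0.
Qed.

Lemma degree_compl G x : (degree (compl G) x + degree G x).+1 = #|T|.
Proof. by rewrite (degree_diff x (@sub_full G)) degree_full. Qed.

Lemma sum_degree G : \sum_x degree G x = 2 * #|edges G|.
Proof.
pose arcs := [set p : T * T | G p.1 p.2].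
pose ends (p : T * T) := [set p.1; p.2].
have -> : edges G = ends @: arcs.
  apply/setP => e; apply/imset2P/imsetP => [[x y _]|[[x y]]].
    by rewrite inE => /andP[_ Gxy] ->; exists (x, y); rewrite ?inE.
  by rewrite inE /= => Gxy ->; exists x y; rewrite ?inE.
transitivity #|arcs|.
  under eq_bigr do rewrite degreeE.
  by rewrite pair_big -sum_mem_card; apply: eq_bigr => p _; rewrite inE.
rewrite -sum1_card (partition_big_imset ends) /= mulnC -sum_nat_const.
apply: eq_bigr => e /imsetP[[x y]]; rewrite inE /= => Gxy ->.
rewrite sum1dep_card (_ : [set _ | _] = [set (x, y); (y, x)]).
  by rewrite cards2 xpair_eqE negb_and (adj_neq Gxy).
apply/setP => -[u v]; rewrite !inE /= !xpair_eqE.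
apply/andP/orP => [[Guv /eqP/setP eq_uv]|].
  have := adj_neq Guv; have := eq_uv u; have := eq_uv v.
  rewrite !inE !eqxx orbT.
  by move=> /esym/orP[] /eqP -> /esym/orP[] /eqP ->; rewrite !eqxx //;
    [right | left].
case=> /andP[/eqP -> /eqP ->]; first by rewrite Gxy.
by rewrite adj_sym Gxy /ends setUC.
Qed.

Lemma card_edges_of_sum_degree G (m : nat) :
  \sum_x degree G x = 2 * m -> #|edges G| = m.
Proof. by rewrite sum_degree => /eqP; rewrite eqn_pmul2l // => /eqP. Qed.

Lemma eq_card_edges G K : G =2 K -> #|edges G| = #|edges K|.
Proof.
move=> eqGK; apply: card_edges_of_sum_degree; rewrite -sum_degree.
by apply: eq_bigr => x _; rewrite !degreeE; apply: eq_bigr => y _; rewrite eqGK.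
Qed.

Lemma card_edges_edge x y : x != y -> #|edges (edge_graph x y)| = 1.
Proof.
move=> nxy; apply: card_edges_of_sum_degree.
by under eq_bigr do rewrite degree_edge //; rewrite big_split /= !sum_pred1.
Qed.

Lemma card_edges_union G K : spanning_subgraph K (compl G) ->
  #|edges (union_graph G K)| = #|edges G| + #|edges K|.
Proof.
move=> disj; apply: card_edges_of_sum_degree; rewrite mulnDr -!sum_degree.
by rewrite -big_split; apply: eq_bigr => x _; rewrite degree_union.
Qed.

Lemma card_edges_diff G K : spanning_subgraph K G ->
  #|edges (diff_graph G K)| + #|edges K| = #|edges G|.
Proof.
move=> sKG; apply/esym/card_edges_of_sum_degree; rewrite mulnDr -!sum_degree.
by rewrite -big_split; apply: eq_bigr => x _; rewrite -(degree_diff x sKG).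
Qed.

Lemma card_edges_full : #|edges full_graph| = 'C(#|T|, 2).
Proof.
apply: card_edges_of_sum_degree; rewrite double_bin2 -sum_nat_const.
by apply: eq_bigr => x _; rewrite -(degree_full x).
Qed.

Lemma card_edges_compl G : #|edges (compl G)| + #|edges G| = 'C(#|T|, 2).
Proof. by rewrite (card_edges_diff (@sub_full G)) card_edges_full. Qed.

Lemma sum_degree_le G A : \sum_(v in A) degree G v <= 2 * #|edges G|.
Proof. by rewrite -sum_degree [leqRHS](bigID (mem A)) leq_addr. Qed.

Lemma spanning_subgraph_eq G K :
  spanning_subgraph G K -> #|edges K| <= #|edges G| -> G =2 K.
Proof.
move=> sGK le_edges u v; apply/idP/idP => [/sGK //|Kuv].
have : \sum_w degree (diff_graph K G) w == 0.
  by rewrite sum_degree; have := card_edges_diff sGK; lia.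
rewrite sum_nat_eq0 => /forallP/(_ u)/=; rewrite -leqn0 leqNgt.
by apply: contraR => nGuv; apply/degree_gt0P; exists v; apply/andP.
Qed.

Definition clique_adj A : rel T := fun u v => [&& u \in A, v \in A & u != v].

Lemma clique_adj_sym A : symmetric (clique_adj A).
Proof. by move=> u v; rewrite /clique_adj andbCA eq_sym. Qed.

Lemma clique_adj_irr A : irreflexive (clique_adj A).
Proof. by move=> u; rewrite /clique_adj eqxx !andbF. Qed.

Definition clique A : sgraph T :=
  SGraph (@clique_adj_sym A) (@clique_adj_irr A).

Lemma degree_clique A w : degree (clique A) w = (w \in A) * #|A|.-1.
Proof.
rewrite degreeE; have [Aw|nAw] := boolP (w \in A); last first.
  by rewrite mul0n big1 // => v _; rewrite /= /clique_adj (negbTE nAw).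
rewrite (cardsD1 w A) Aw mul1n add1n -sum_mem_card; apply: eq_bigr => v _.
by rewrite in_setD1 andbC eq_sym /= /clique_adj Aw.
Qed.

Lemma card_edges_clique A : #|edges (clique A)| = 'C(#|A|, 2).
Proof.
apply: card_edges_of_sum_degree; rewrite double_bin2.
by under eq_bigr do rewrite degree_clique; rewrite -big_distrl sum_mem_card.
Qed.

Lemma clique_of_card_edges G A : (forall w, w \notin A -> degree G w = 0) ->
  'C(#|A|, 2) <= #|edges G| -> G =2 clique A.
Proof.
move=> deg0; rewrite -card_edges_clique; apply: spanning_subgraph_eq => u v Guv.
have inA p q : G p q -> p \in A.
  move=> Gpq; apply: contraT => /deg0; suff : 0 < degree G p by case: degree.
  by apply/degree_gt0P; exists q.
apply/and3P; split; [exact: inA Guv | | exact: adj_neq Guv].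
by apply: (inA v u); rewrite adj_sym.
Qed.

Definition nbrs_in G A v : nat := \sum_(u in A) G u v.

Lemma sum_nbrs_in G A : \sum_v nbrs_in G A v = \sum_(u in A) degree G u.
Proof. by under [RHS]eq_bigr do rewrite degreeE; rewrite exchange_big. Qed.

Lemma nbrs_in_split G A v :
  degree G v = nbrs_in G A v + \sum_(u | u \notin A) G u v.
Proof.
rewrite degreeE (bigID (mem A)).
by congr (_ + _); apply: eq_bigr => u _; rewrite adj_sym.
Qed.

Lemma nbrs_in_le_degree G A v : nbrs_in G A v <= degree G v.
Proof. by rewrite (nbrs_in_split G A) leq_addr. Qed.

Lemma nbrs_in_out G A v y : y \notin A -> nbrs_in G A v + G y v <= degree G v.
Proof.
by move=> nAy; rewrite (nbrs_in_split G A) leq_add2l (bigD1 y) //= leq_addr.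
Qed.

Lemma nbrs_in_eq_degree G A v u :
  nbrs_in G A v = degree G v -> G u v -> u \in A.
Proof.
move=> all_in Guv; apply: contraT => nAu.
by have := nbrs_in_out G v nAu; rewrite all_in Guv addn1 ltnn.
Qed.

End Graphs.

(** * Exchanges along alternating paths *)

Section Exchange.
Variables (T : finType) (L M : sgraph T) (c : nat).
Implicit Types (E : sgraph T) (x y u v w : T).

Definition admissible E : Prop :=
  [/\ spanning_subgraph L E, spanning_subgraph E M
    & forall w, degree E w <= c].

Definition optimal E : Prop := admissible E /\
  forall E', admissible E' -> #|edges E'| <= #|edges E|.

(* For x = y this asks for two missing units of degree at x. *)
Definition raisable E x y : Prop :=
  forall w, degree E w + (w == x) + (w == y) <= c.

Definition deficient_pair E x y : Prop :=
  [/\ optimal E, raisable E x y & x != y].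

Definition free_nbrs E x : {set T} := [set u | diff_graph M E x u].

Lemma ex_optimal : spanning_subgraph L M -> (forall w, degree L w <= c) ->
  exists E, optimal E.
Proof.
move=> sLM degL.
have [||E admE maxE] := @ex_max_measure _ admissible (fun E => #|edges E|)
    #|{: {set T}}|; last by exists E.
  by move=> E _; apply: max_card.
by exists L; split=> // u v.
Qed.

Lemma raisable_sym E x y : raisable E x y -> raisable E y x.
Proof. by move=> r w; have := r w; lia. Qed.

Lemma deficient_pair_sym E x y : deficient_pair E x y -> deficient_pair E y x.
Proof. by case=> o r n; split=> //; [exact: raisable_sym | rewrite eq_sym]. Qed.

Lemma raisable_lt E x y : raisable E x y -> degree E x < c.
Proof. by move=> r; have := r x; rewrite eqxx; lia. Qed.

Lemma lt_raisable E x y : (forall w, degree E w <= c) -> x != y ->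
  degree E x < c -> degree E y < c -> raisable E x y.
Proof.
move=> degE nxy lt_x lt_y w; have := degE w.
have [->|_] := eqVneq w x; first by rewrite (negbTE nxy); lia.
by have [->|_] := eqVneq w y; lia.
Qed.

Lemma not_raisable_degrees E : admissible E -> (forall x y, ~ raisable E x y) ->
  (forall w, degree E w = c) \/ exists x, forall w, degree E w + (w == x) = c.
Proof.
move=> [_ _ degE] nr.
have [/forallP Ec|/forallPn[x nEx]] := boolP [forall w, degree E w == c].
  by left=> w; apply/eqP.
right; exists x => w; apply/eqP; rewrite eqn_leq.
have lt_x : degree E x < c by rewrite ltn_neqAle nEx degE.
have [->|nwx] := eqVneq w x; rewrite ?addn1 ?addn0.
  rewrite lt_x leqNgt; apply/negP => lt2; apply: (nr x x) => u.
  by have := degE u; have [->|_] := eqVneq u x; lia.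
rewrite degE leqNgt; apply/negP => lt_w.
exact: (nr w x) (lt_raisable degE nwx lt_w lt_x).
Qed.

Lemma free_nbrs_sym E x u : (u \in free_nbrs E x) = (x \in free_nbrs E u).
Proof. by rewrite !inE adj_sym. Qed.

Lemma free_nbrs_irr E x : x \notin free_nbrs E x.
Proof. by rewrite inE adj_irr. Qed.

Lemma card_free_nbrs E x : spanning_subgraph E M ->
  #|free_nbrs E x| + degree E x = degree M x.
Proof. exact: degree_diff. Qed.

Lemma free_nbrs_edge E x u : u \in free_nbrs E x ->
  spanning_subgraph (edge_graph x u) (diff_graph M E).
Proof. by rewrite inE; apply: edge_graph_sub. Qed.

Lemma union_free_edge E x u : u \in free_nbrs E x ->
  spanning_subgraph E M -> spanning_subgraph (union_graph E (edge_graph x u)) M.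
Proof.
by move=> Fu sEM p q /orP[/sEM //|/(free_nbrs_edge Fu)/andP[]].
Qed.

Lemma free_edge_disjoint E x u : u \in free_nbrs E x ->
  spanning_subgraph (edge_graph x u) (compl E).
Proof.
move=> Fu p q /(free_nbrs_edge Fu)/andP[/adj_neq npq nEpq].
by rewrite complE npq.
Qed.

Lemma free_nbrs_neq E x u : u \in free_nbrs E x -> x != u.
Proof. by rewrite inE => /adj_neq. Qed.

Lemma raisable_not_free E x y :
  optimal E -> raisable E x y -> y \notin free_nbrs E x.
Proof.
move=> [[sLE sEM degE] maxE] r; apply/negP => Fy.
have /maxE : admissible (union_graph E (edge_graph x y)).
  split=> [u v /sLE Euv||w]; first by rewrite /= /union_adj Euv.
    exact: union_free_edge.
  by rewrite degree_union ?degree_edge ?addnA ?(free_nbrs_neq Fy) //;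
    apply: free_edge_disjoint.
rewrite card_edges_union ?card_edges_edge ?(free_nbrs_neq Fy) //; first by lia.
exact: free_edge_disjoint.
Qed.

Lemma free_nbr_saturated E x u : optimal E ->
  degree E x < c -> u \in free_nbrs E x -> degree E u = c.
Proof.
move=> optE lt_x Fu; have [[_ _ degE] _] := optE.
apply/eqP; rewrite eqn_leq degE leqNgt; apply/negP => lt_u.
have r := lt_raisable degE (free_nbrs_neq Fu) lt_x lt_u.
by have := raisable_not_free optE r; rewrite Fu.
Qed.

Lemma sum_nbrs_in_free E x : optimal E -> degree E x < c ->
  \sum_v nbrs_in E (free_nbrs E x) v = c * #|free_nbrs E x|.
Proof.
move=> optE lt_x; rewrite sum_nbrs_in mulnC -sum_nat_const.
by apply: eq_bigr => u /(free_nbr_saturated optE lt_x).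
Qed.

Lemma free_nbrs_not_adj E x u : u \in free_nbrs E x -> ~~ E u x.
Proof. by rewrite inE => /andP[_]; rewrite adj_sym. Qed.

Definition reach E x : {set T} := [set v | [exists u in free_nbrs E x, E u v]].

Lemma mem_reach E x u v : u \in free_nbrs E x -> E u v -> v \in reach E x.
Proof. by move=> Fu Euv; rewrite inE; apply/exists_inP; exists u. Qed.

Lemma reach_irr E x : x \notin reach E x.
Proof.
rewrite inE; apply/exists_inP => -[u /free_nbrs_not_adj].
by case: (E u x).
Qed.

Lemma card_reach_ge E x u : optimal E -> degree E x < c ->
  u \in free_nbrs E x -> c <= #|reach E x|.
Proof.
move=> optE lt_x Fu; rewrite -(free_nbr_saturated optE lt_x Fu).
apply/subset_leq_card/subsetP => v; rewrite inE; exact: mem_reach.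
Qed.

(* Along the alternating path x - u - v the deficiency moves from x to v. *)
Definition shift_edge E x u v : sgraph T :=
  union_graph (diff_graph E (edge_graph u v)) (edge_graph x u).

Lemma shift_edge_disjoint E x u v : u \in free_nbrs E x ->
  spanning_subgraph (edge_graph x u) (compl (diff_graph E (edge_graph u v))).
Proof.
move=> /free_edge_disjoint disj p q /disj; rewrite !complE => /andP[-> nEpq].
by rewrite /= /diff_adj negb_and nEpq.
Qed.

Lemma degree_shift E x u v w : u \in free_nbrs E x -> E u v ->
  degree (shift_edge E x u v) w + (w == v) = degree E w + (w == x).
Proof.
move=> Fu Euv; rewrite degree_union; last exact: shift_edge_disjoint.
have := degree_diff w (edge_graph_sub Euv).
by rewrite !degree_edge ?(adj_neq Euv) ?(free_nbrs_neq Fu) //; lia.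
Qed.

Lemma shift_admissible E x y u v : admissible E -> raisable E x y ->
  u \in free_nbrs E x -> E u v -> ~~ L u v -> admissible (shift_edge E x u v).
Proof.
move=> [sLE sEM degE] r Fu Euv nLuv; split=> [p q Lpq||w].
- apply/orP; left; rewrite /= /diff_adj (sLE _ _ Lpq) /=.
  by apply: contra nLuv => /edge_graphP[] [<- <-] //; rewrite adj_sym.
- by move=> p q /orP[/andP[/sEM] //|/(free_nbrs_edge Fu)/andP[]].
- by have := degree_shift w Fu Euv; have := r w; lia.
Qed.

Lemma card_edges_shift E x u v : u \in free_nbrs E x -> E u v ->
  #|edges (shift_edge E x u v)| = #|edges E|.
Proof.
move=> Fu Euv; rewrite card_edges_union; last exact: shift_edge_disjoint.
rewrite -(card_edges_diff (edge_graph_sub Euv)).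
by rewrite !card_edges_edge ?(adj_neq Euv) ?(free_nbrs_neq Fu).
Qed.

Lemma shift_optimal E x y u v : optimal E -> raisable E x y ->
  u \in free_nbrs E x -> E u v -> ~~ L u v -> optimal (shift_edge E x u v).
Proof.
move=> [admE maxE] r Fu Euv nLuv; split; first exact: shift_admissible r _ _ _.
by move=> E' /maxE; rewrite card_edges_shift.
Qed.

Lemma shift_raisable E x y u v : raisable E x y ->
  u \in free_nbrs E x -> E u v -> raisable (shift_edge E x u v) v y.
Proof.
by move=> r Fu Euv w; have := degree_shift w Fu Euv; have := r w; lia.
Qed.

Lemma ex_deficient_pair E x y : optimal E -> raisable E x y ->
  (x = y -> exists2 u, u \in free_nbrs E x & degree L u < c) ->
  exists E' x' y', deficient_pair E' x' y'.
Proof.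
move=> optE r; have [eq_xy|nxy] := eqVneq x y; last by exists E, x, y.
move: r; rewrite -eq_xy => r [//|u Fu lt_u].
have [v Euv nLuv] : exists2 v, E u v & ~~ L u v.
  have deg_u := free_nbr_saturated optE (raisable_lt r) Fu.
  have [[sLE _ _] _] := optE.
  have /degree_gt0P[v /andP[]] : 0 < degree (diff_graph E L) u;
    last by exists v.
  by rewrite -(ltn_add2r (degree L u)) degree_diff ?deg_u.
exists (shift_edge E x u v), v, x; split.
- exact: shift_optimal r Fu Euv nLuv.
- exact: shift_raisable r Fu Euv.
- by apply: contraTneq Euv => ->; apply: free_nbrs_not_adj.
Qed.

Lemma free_free_adj E x y u v : optimal E -> raisable E x y ->
  u \in free_nbrs E x -> v \in free_nbrs E y -> E u v -> L u v.
Proof.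
move=> optE r Fu Fv Euv; apply: contraT => nLuv.
have := raisable_not_free (shift_optimal optE r Fu Euv nLuv)
  (raisable_sym (shift_raisable r Fu Euv)).
have /andP[Myv nEyv] : diff_graph M E y v by rewrite inE in Fv.
rewrite inE /= {1}/diff_adj Myv negbK => /orP[/andP[Eyv _]|/edge_graphP[]].
- by rewrite Eyv in nEyv.
- by case=> _ Ev; rewrite Ev adj_irr in Euv.
- by case=> Ey _; have := raisable_not_free optE r; rewrite Ey Fu.
Qed.

Section Counting.
Variables (E : sgraph T) (x y : T).
Hypothesis dxy : deficient_pair E x y.
Local Notation P := (free_nbrs E x).
Local Notation Q := (free_nbrs E y).

Definition free_arcs : nat := \sum_(v in Q) nbrs_in E P v.

(* The c|P| arcs leaving P end in Q, at y or in the set A of vertices outside Q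
   other than x and y. Since y is not in P, each neighbour of y in A receives
   at most c - 1 of them; as the neighbours of y in P all lie in A, this makes
   up for the arcs ending at y. *)
Lemma count_free_arcs : c * (#|P| + #|Q| + 2) <= free_arcs + c * #|T|.
Proof.
have [optE r nxy] := dxy; have [[_ _ degE] _] := optE.
have nPy : y \notin P := raisable_not_free optE r.
have nQx : x \notin Q by rewrite -free_nbrs_sym.
pose A := ~: (x |: (y |: Q)).
have card_A : #|A| + #|Q| + 2 = #|T|.
  rewrite -(cardsC (x |: (y |: Q))) !cardsU1 in_setU1 !negb_or nxy nQx.
  by rewrite free_nbrs_irr -/A; lia.
have sum_A : nbrs_in E P y + \sum_(v in A) nbrs_in E P v <= c * #|A|.
  apply: (@leq_trans (\sum_(v in A) degree E v)); last first.
    by rewrite mulnC -sum_nat_const; apply: leq_sum => v _.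
  apply: (@leq_trans (\sum_(v in A) (E y v + nbrs_in E P v))); last first.
    by apply: leq_sum => v _; rewrite addnC nbrs_in_out.
  rewrite big_split leq_add2r /nbrs_in big_mkcond [leqRHS]big_mkcond.
  apply: leq_sum => u _; case: ifP => // Pu; rewrite adj_sym.
  case Eyu: (E y u) => //; rewrite !inE /= /diff_adj Eyu andbF orbF negb_or.
  by rewrite eq_sym (free_nbrs_neq Pu) eq_sym (adj_neq Eyu).
have arcs_P :
    c * #|P| = nbrs_in E P y + \sum_(v in A) nbrs_in E P v + free_arcs.
  have Px0 : nbrs_in E P x = 0.
    by apply: big1 => u /free_nbrs_not_adj/negbTE ->.
  rewrite -(sum_nbrs_in_free optE (raisable_lt r)).
  rewrite (bigID (mem (x |: (y |: Q)))) /= addnC.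
  rewrite !big_setU1 /= ?in_setU1 ?negb_or ?nxy ?free_nbrs_irr //.
  rewrite Px0 add0n addnCA addnA.
  by congr (_ + _ + _); apply: eq_bigl => v; rewrite in_setC.
by rewrite -card_A !mulnDr; lia.
Qed.

Lemma card_reach : #|P| <= #|reach E x :\ y|.
Proof.
have [optE r _] := dxy; have [[_ _ degE] _] := optE.
have lt_x := raisable_lt r; have lt_y := raisable_lt (raisable_sym r).
have sum_reach : \sum_(v | v != y) nbrs_in E P v <= c * #|reach E x :\ y|.
  rewrite -sum_mem_card big_distrr [leqRHS](bigD1 y) //= setD11 muln0 add0n.
  apply: leq_sum => v nvy; rewrite in_setD1 nvy /=.
  have [_|nRv] := boolP (v \in reach E x).
    by rewrite muln1; apply: leq_trans (nbrs_in_le_degree _ _ _) (degE v).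
  rewrite [nbrs_in _ _ _]big1 // => u Pu; apply/eqP; rewrite eqb0.
  by apply: contra nRv; apply: mem_reach.
rewrite -ltnS -(ltn_pmul2l (leq_ltn_trans (leq0n _) lt_x)).
rewrite -(sum_nbrs_in_free optE lt_x) (bigD1 y) //= mulnS.
by have := nbrs_in_le_degree E P y; lia.
Qed.

Lemma free_arcs_le : free_arcs <= \sum_(v in Q) nbrs_in L P v.
Proof.
have [optE r _] := dxy; apply: leq_sum => v Fv; apply: leq_sum => u Fu.
by case Euv: (E u v) => //; rewrite (free_free_adj optE r Fu Fv Euv).
Qed.

Lemma free_arcs_le_degree : free_arcs <= \sum_(v in Q) degree L v.
Proof.
apply: leq_trans free_arcs_le _; apply: leq_sum => v _.
exact: nbrs_in_le_degree.
Qed.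

End Counting.
End Exchange.

(** * Near-regular spanning subgraphs *)

Definition near_regular (T : finType) (a : nat) (F : sgraph T) : Prop :=
  (forall w, degree F w = a) \/ exists x, forall w, degree F w = a + (w == x).

Lemma near_regular_factor (T : finType) (G F : sgraph T) (a b : nat) :
  a <= b -> (a = b -> #|T| * a = 0 %[mod 2]) ->
  spanning_subgraph F G -> near_regular a F -> is_factor a b F G.
Proof.
move=> le_ab parity sFG [reg|[x reg]]; split=> // w; rewrite reg ?leqnn //.
suff lt_ab : a < b by case: (w == x); lia.
rewrite ltn_neqAle le_ab andbT; apply/eqP => /parity.
have := sum_degree F; under eq_bigr do rewrite reg.
by rewrite big_split /= sum_pred1 sum_nat_const; move: (_ * a) => m; lia.
Qed.

Section NearRegular.
Variable T : finType.
Implicit Types H M : sgraph T.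

Lemma near_regular_or_deficient_pair M (a : nat) :
  (forall w, a <= degree M w) ->
  (exists2 F, spanning_subgraph F M & near_regular a F) \/
  exists E x y, deficient_pair (empty_graph T) M a E x y.
Proof.
move=> degM.
have [|w|E optE] := @ex_optimal T (empty_graph T) M a; rewrite ?degree_empty //.
have [admE _] := optE; have [_ sEM _] := admE.
have free_gt0 x : degree E x < a -> exists u, u \in free_nbrs M E x.
  move=> lt_x; apply/card_gt0P.
  by have := card_free_nbrs x sEM; have := degM x; lia.
have [[x [y r]]|nr] := classic (exists x y, raisable a E x y).
  right; apply: (ex_deficient_pair optE r) => _; have lt_x := raisable_lt r.
  by have [u Fu] := free_gt0 x lt_x; exists u; rewrite ?degree_empty //; lia.
have {}nr x y : ~ raisable a E x y by move=> r; apply: nr; exists x, y.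
left; have [reg|[x reg]] := not_raisable_degrees admE nr.
  by exists E => //; left.
have lt_x : degree E x < a by rewrite -(reg x) eqxx addn1.
have [u Fu] := free_gt0 x lt_x.
exists (union_graph E (edge_graph x u)); first exact: union_free_edge.
right; exists u => w; rewrite degree_union; last exact: free_edge_disjoint Fu.
by rewrite degree_edge ?(free_nbrs_neq Fu) // addnA reg.
Qed.

Lemma near_regular_compl_or_raisable H (k : nat) :
  (forall w, degree H w <= k) -> k < #|T| ->
  (exists2 F, spanning_subgraph F (compl H) & near_regular (#|T| - k.+1) F) \/
  exists E x y, optimal H (full_graph T) k E /\ raisable k E x y.
Proof.
move=> degH lt_k.
have [E optE] := ex_optimal (@sub_full _ H) degH.
have [admE _] := optE; have [sHE _ _] := admE.
have [[x [y r]]|nr] := classic (exists x y, raisable k E x y).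
  by right; exists E, x, y.
have {}nr x y : ~ raisable k E x y by move=> r; apply: nr; exists x, y.
left; exists (compl E).
  by apply: sub_complC => u v /sHE Euv; apply: sub_complC Euv.
have [reg|[x reg]] := not_raisable_degrees admE nr.
  by left=> w; have := degree_compl E w; rewrite reg; lia.
by right; exists x => w; have := degree_compl E w; have := reg w; lia.
Qed.

End NearRegular.

(** * Supergraphs of a sparse graph *)

Section SparseSupergraph.
Variables (T : finType) (H : sgraph T) (k : nat).
Hypothesis edges_H : #|edges H| <= k.+1.
Implicit Types (E : sgraph T) (x y u v w : T).
Local Notation free := (free_nbrs (full_graph T)).

Lemma card_free_full E x : (#|free E x| + degree E x).+1 = #|T|.
Proof. by rewrite (card_free_nbrs x (@sub_full _ E)) degree_full. Qed.

Lemma sum_degree_sparse (A : {set T}) : \sum_(v in A) degree H v <= 2 * k.+1.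
Proof. by apply: leq_trans (sum_degree_le _ _) _; rewrite leq_mul2l. Qed.

Lemma sparse_deficient_pair E x y : k.*2 <= #|T| -> (k = 2 -> 4 < #|T|) ->
  optimal H (full_graph T) k E -> raisable k E x y ->
  exists E' x' y', deficient_pair H (full_graph T) k E' x' y'.
Proof.
move=> le_n n_gt4 optE r; apply: (ex_deficient_pair optE r) => eq_xy.
have [/exists_inP //|no_u] := boolP [exists u in free E x, degree H u < k].
have : k * #|free E x| <= \sum_(u in free E x) degree H u.
  rewrite mulnC -sum_nat_const; apply: leq_sum => u Fu; rewrite leqNgt.
  by apply: contra no_u => lt_u; apply/exists_inP; exists u.
have := sum_degree_sparse (free E x); have := card_free_full E x; have := r x.
by rewrite -eq_xy eqxx; nia.
Qed.

Section DeficientPair.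
Variables (E : sgraph T) (x y : T).
Hypothesis dxy : deficient_pair H (full_graph T) k E x y.
Local Notation P := (free E x).
Local Notation Q := (free E y).

Lemma free_arcs_ge :
  k * (#|T| + 2) <= free_arcs (full_graph T) E x y + 2 * (k * k).
Proof.
have [_ r _] := dxy; have := count_free_arcs dxy.
have := card_free_full E x; have := card_free_full E y.
have := raisable_lt r; have := raisable_lt (raisable_sym r); nia.
Qed.

Lemma sparse_clique : k.*2 < #|T| ->
  [/\ k = 2, #|T| = 5 & exists2 S : {set T}, #|S| = 3 & H =2 clique S].
Proof.
move=> lt_n; have [[[sHE _ degE] _] r _] := dxy.
have lt_x := raisable_lt r; have lt_y := raisable_lt (raisable_sym r).
have card_P := card_free_full E x; have card_Q := card_free_full E y.
have sum_Q := sum_degree_sparse Q; have arcs_Q := free_arcs_le_degree dxy.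
have k2 : k = 2.
  have : \sum_(v in Q) degree H v <= k * #|Q|.
    rewrite mulnC -sum_nat_const; apply: leq_sum => v _.
    exact: leq_trans (degree_le v sHE) (degE v).
  have k_le2 : k <= 2 by have := free_arcs_ge; nia.
  by case: (k) free_arcs_ge k_le2 lt_y lt_n => [|[|[|]]] //; lia.
have T5 : #|T| = 5 by have := free_arcs_ge; rewrite k2 in lt_n sum_Q *; lia.
have count := count_free_arcs dxy.
split=> //; exists Q; first by rewrite k2 in lt_x lt_y sum_Q count; lia.
have edges_Q : 2 * 3 <= \sum_(v in Q) degree H v.
  by apply: leq_trans arcs_Q; have := free_arcs_ge; rewrite k2 T5; lia.
apply: clique_of_card_edges => [w nQw|].
  have : \sum_(v | v \notin Q) degree H v == 0.
    have : \sum_v degree H v <= 2 * k.+1 by rewrite sum_degree leq_mul2l.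
    by rewrite (bigID [in Q]) k2 /=; lia.
  by rewrite sum_nat_eq0 => /forall_inP/(_ w nQw)/eqP.
have -> : #|Q| = 3 by rewrite k2 in lt_x lt_y sum_Q count; lia.
rewrite -(leq_pmul2l (_ : 0 < 2)) //.
exact: leq_trans edges_Q (sum_degree_le _ _).
Qed.

(* The count makes all k vertices of Q lie in S and have both their neighbours
   in P; as these k vertices dominate the k + 1 vertices of S, P contains S. *)
Lemma sparse_not_two_regular (S : {set T}) :
  2 < k -> #|T| = k.*2 -> #|S| = k.+1 ->
  ~ (forall w, degree H w = 2 * (w \in S)).
Proof.
move=> k_gt2 card_T card_S degH; have [_ r _] := dxy.
have lt_x := raisable_lt r; have lt_y := raisable_lt (raisable_sym r).
have card_P := card_free_full E x; have card_Q := card_free_full E y.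
have sum_Q := sum_degree_sparse Q; have arcs_Q := free_arcs_le_degree dxy.
have count := count_free_arcs dxy.
have [P_k Q_k] : #|P| = k /\ #|Q| = k by nia.
have in_Q v : v \in Q -> nbrs_in H P v = 2.
  have deg_le2 w : nbrs_in H P w <= 2.
    apply: leq_trans (nbrs_in_le_degree _ _ _) _.
    by rewrite degH; case: (w \in S).
  apply: (leq_sum_eq (P := mem Q) (f := nbrs_in H P) (g := fun=> 2)) => //.
  rewrite sum_nat_const Q_k; apply: leq_trans (free_arcs_le dxy).
  by have := free_arcs_ge; rewrite card_T; nia.
have in_S u v : H u v -> v \in S.
  move=> Huv; have : 0 < degree H v.
    by apply/degree_gt0P; exists u; rewrite adj_sym.
  by rewrite degH; case: (v \in S).
have all_nbrs_P v : v \in Q -> nbrs_in H P v = degree H v.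
  move=> Qv; apply/eqP; rewrite eqn_leq nbrs_in_le_degree in_Q // degH.
  by case: (v \in S).
have sQS : Q \subset S.
  apply/subsetP => v Qv; have := all_nbrs_P v Qv.
  by rewrite in_Q // degH; case: (v \in S).
suff /subset_leq_card : S \subset P by rewrite P_k card_S ltnn.
apply/subsetP => v Sv.
suff [u Qu Hvu] : exists2 u, u \in Q & H v u.
  exact: nbrs_in_eq_degree (all_nbrs_P u Qu) Hvu.
apply/exists_inP; apply: contraT => no_u.
have : degree H v <= #|S :\: Q|.
  apply/subset_leq_card/subsetP => u; rewrite inE => Hvu.
  rewrite in_setD (in_S v) // andbT.
  by apply: contra no_u => Qu; apply/exists_inP; exists u.
by rewrite degH Sv cardsD (setIidPr sQS) card_S Q_k; lia.
Qed.

End DeficientPair.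
End SparseSupergraph.

(** * Subgraphs of a dense graph *)

Section DenseFactor.
Variables (T : finType) (H : sgraph T) (a N : nat).
Hypotheses (a_gt0 : 0 < a) (card_T : #|T| = a + N) (dense : a.+1 < N).
Hypotheses (degH : forall w, degree H w < N) (edges_H : #|edges H| <= N).
Implicit Types (E : sgraph T) (x y u v w : T).
Local Notation h := (degree H).
Local Notation free := (free_nbrs (compl H)).
Local Notation reach := (reach (compl H)).
Local Notation pair := (deficient_pair (empty_graph T) (compl H) a).

Lemma deficient_pair_shift E x y v : pair E x y -> v \in reach E x -> v != y ->
  exists E', pair E' v y.
Proof.
move=> [optE r nxy]; rewrite inE => /exists_inP[u Fu Euv] nvy.
exists (shift_edge E x u v); split=> //; first exact: shift_optimal r Fu Euv _.
exact: shift_raisable r Fu Euv.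
Qed.

Lemma card_free E x y :
  pair E x y -> #|free E x| + degree E x + h x + 1 = a + N.
Proof.
case=> [[[_ sE _] _] _ _].
rewrite card_free_nbrs // -card_T -(degree_compl H x).
by rewrite addn1.
Qed.

Lemma deficient_pair_degree_sum E x y : pair E x y -> N + 2 <= h x + h y + a.
Proof.
move=> d; have := count_free_arcs d; have := free_arcs_le_degree d.
rewrite big1 => [|v _]; last exact: degree_empty.
rewrite leqn0 => /eqP ->; rewrite add0n leq_pmul2l // card_T.
have := card_free d; have := card_free (deficient_pair_sym d).
case: d => _ r _; have := raisable_lt r; have := raisable_lt (raisable_sym r).
lia.
Qed.

Section MinimalPair.
Variables (E : sgraph T) (x y : T).
Hypothesis dxy : pair E x y.
Hypothesis min_y : forall E' x' y', pair E' x' y' -> h y <= h y'.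

Let core := x |: (y |: (reach E y :\ x)).
Let rim := x |: (reach E x :\ y).

Lemma degree_core v : v \in core -> h y <= h v.
Proof.
case/setU1P=> [->|/setU1P[-> //|/setD1P[nvx Rv]]].
  exact: min_y (deficient_pair_sym dxy).
have [E' d'] := deficient_pair_shift (deficient_pair_sym dxy) Rv nvx.
exact: min_y (deficient_pair_sym d').
Qed.

Lemma degree_rim v : v \in rim -> h y <= h v /\ N + 2 <= h v + h y + a.
Proof.
case/setU1P=> [->|/setD1P[nvy Rv]].
  split; first exact: min_y (deficient_pair_sym dxy).
  exact: deficient_pair_degree_sum dxy.
have [E' d'] := deficient_pair_shift dxy Rv nvy.
split; first exact: min_y (deficient_pair_sym d').
exact: deficient_pair_degree_sum d'.
Qed.

Lemma card_core : N + 2 <= #|core| + h y.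
Proof.
have dyx := deficient_pair_sym dxy; have [_ r nyx] := dyx.
have := card_reach dyx; have := card_free dyx; have := raisable_lt r.
rewrite /core !cardsU1 !in_setU1 !in_setD1 eqxx eq_sym (negbTE nyx).
by rewrite (negbTE (reach_irr _ E y)) andbF; lia.
Qed.

Lemma card_rim : a <= #|rim|.
Proof.
have [optE r _] := dxy; have lt_x := raisable_lt r.
have /card_gt0P[u Fu] : 0 < #|free E x|.
  by have := card_free dxy; have := degH x; lia.
rewrite cardsU1 in_setD1 (negbTE (reach_irr _ E x)) andbF.
apply: leq_trans (card_reach_ge optE lt_x Fu) _.
by rewrite (cardsD1 y (reach E x)) leq_add2r leq_b1.
Qed.

Lemma sum_core_rim :
  h y * #|core| + (N + 2 - a - (h y).*2) * #|rim| <= N.*2.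
Proof.
apply: (@leq_trans (\sum_v h v)); last by rewrite sum_degree mul2n leq_double.
rewrite -2!sum_mem_card !big_distrr -big_split; apply: leq_sum => v _ /=.
move: (@degree_rim v) (@degree_core v).
case: (v \in rim) => [/(_ isT)[ge_y ge_N]|_];
  by case: (v \in core) => [/(_ isT)|_]; lia.
Qed.

Lemma minimal_degree : h y = 2 /\ N = a + 2.
Proof.
have := sum_core_rim; have := card_core; have := card_rim.
have := deficient_pair_degree_sum dxy; have := degH x; have := degH y.
have := degree_core (setU11 _ _).
move: (h y) (h x) #|core| #|rim| => s t p q st sN tN sum_st le_q le_p sums.
(* The first term alone gives s (N + 2 - s) <= 2 N, i.e. (s - 2) (N - s) <= 0;
   for s <= 1 we get a >= 3 - s from sum_st and t < N, and then the second term
   is too large, as q >= a and N >= a + 2. *)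
have s_le2 : s <= 2 by nia.
have [s0|[s1|s2]] : s = 0 \/ s = 1 \/ s = 2 by lia.
- by exfalso; subst; nia.
- by exfalso; subst; nia.
- by subst; nia.
Qed.

Lemma minimal_two_regular :
  N = a + 2 /\ exists2 S : {set T}, #|S| = N & forall w, h w = 2 * (w \in S).
Proof.
have [hy N_eq] := minimal_degree; split=> //; exists core.
  have := sum_core_rim; have := card_core; rewrite hy.
  by move: (_ * #|rim|) => z; lia.
move=> w; symmetry.
apply: (leq_sum_eq (P := predT) (f := fun w => 2 * (w \in core))) => // [v _|].
  by have [/degree_core|] := boolP (v \in core); rewrite ?hy.
rewrite -big_distrr sum_mem_card sum_degree leq_mul2l /=.
by apply: leq_trans edges_H _; have := card_core; rewrite hy; lia.
Qed.

End MinimalPair.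

Lemma dense_two_regular E x y : pair E x y ->
  N = a + 2 /\ exists2 S : {set T}, #|S| = N & forall w, h w = 2 * (w \in S).
Proof.
move=> d; pose P (t : sgraph T * T * T) := pair t.1.1 t.1.2 t.2.
have [|[[E0 x0] y0] d0 min0] := @ex_min_measure _ P (fun t => h t.2).
  by exists (E, x, y).
by apply: (minimal_two_regular d0) => E' x' y' d'; apply: (min0 (E', x', y')).
Qed.

End DenseFactor.

Lemma near_regular_or_clique (T : finType) (H : sgraph T) (a N : nat) :
  0 < a -> #|T| = a + N -> (forall w, degree H w < N) -> #|edges H| <= N ->
  (exists2 F, spanning_subgraph F (compl H) & near_regular a F) \/
  [/\ a = 1 \/ a = 2, N = 3 & exists2 S : {set T}, #|S| = 3 & H =2 clique S].
Proof.
move=> a_gt0 card_T degH edges_H.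
have /card_gt0P[z _] : 0 < #|T| by rewrite card_T addn_gt0 a_gt0.
case: N card_T degH edges_H => [_ /(_ z) //|k card_T degH edges_H].
have above : (exists2 F, spanning_subgraph F (compl H) & near_regular a F) \/
    exists E x y, optimal H (full_graph T) k E /\ raisable k E x y.
  have -> : a = #|T| - k.+1 by rewrite card_T addnK.
  by apply: near_regular_compl_or_raisable => //; lia.
have [le_k|gt_k] := leqP k a.
  case: above => [|[E [x [y [optE r]]]]]; [by left | right].
  have [||E' [x' [y' d]]] := sparse_deficient_pair edges_H _ _ optE r; try lia.
  have [|k2 card5 clique_H] := sparse_clique edges_H d; first by lia.
  by split=> //; lia.
have [w|//|[E [x [y d]]]] := @near_regular_or_deficient_pair T (compl H) a.
- by have := degree_compl H w; have := degH w; lia.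
- by left.
have [k_eq [S card_S degS]] :=
  dense_two_regular a_gt0 card_T gt_k degH edges_H d.
have [a1|a_gt1] : a = 1 \/ 1 < a by lia.
  right; split; [by left | lia | exists S; first lia].
  apply: clique_of_card_edges => [w nSw|]; first by rewrite degS (negbTE nSw).
  rewrite -(leq_pmul2l (_ : 0 < 2)) // -sum_degree.
  under eq_bigr do rewrite degS.
  by rewrite -big_distrr sum_mem_card card_S k_eq a1.
case: above => [|[E' [x' [y' [optE r]]]]]; first by left.
have [||E1 [x1 [y1 d1]]] := sparse_deficient_pair edges_H _ _ optE r; try lia.
by case: (sparse_not_two_regular edges_H d1 _ _ _ degS); lia.
Qed.

(** * The extremal graphs *)

Definition star_adj (T : finType) (H : sgraph T) (x : T) : rel T :=
  fun u v => H u v && ((u == x) || (v == x)).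

Section Star.
Variables (T : finType) (H : sgraph T) (x : T).

Lemma star_adj_sym : symmetric (star_adj H x).
Proof. by move=> u v; rewrite /star_adj adj_sym orbC. Qed.

Lemma star_adj_irr : irreflexive (star_adj H x).
Proof. by move=> u; rewrite /star_adj adj_irr. Qed.

Definition star_at : sgraph T := SGraph star_adj_sym star_adj_irr.

Lemma star_at_sub : spanning_subgraph star_at H.
Proof. by move=> u v /andP[]. Qed.

Lemma card_edges_star : #|edges star_at| = degree H x.
Proof.
apply: card_edges_of_sum_degree; rewrite (bigD1 x) //= mul2n -addnn.
have -> : degree star_at x = degree H x.
  by apply: eq_card => v; rewrite !inE /= /star_adj eqxx andbT.
congr (_ + _); rewrite [RHS]degreeE [RHS](bigD1 x) //= adj_irr add0n.
apply: eq_bigr => u nux; rewrite degreeE (bigD1 x) //= big1 => [|v nvx].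
  by rewrite /star_adj eqxx orbT andbT addn0 adj_sym.
by rewrite /star_adj (negbTE nux) (negbTE nvx) andbF.
Qed.

Lemma degree_le_edges : degree H x <= #|edges H|.
Proof. by rewrite -card_edges_star -(card_edges_diff star_at_sub) leq_addl. Qed.

Lemma star_of_degree : #|edges H| <= degree H x -> star_at =2 H.
Proof.
by rewrite -card_edges_star; apply: spanning_subgraph_eq star_at_sub.
Qed.

End Star.

Definition cut_adj (T : finType) (A : {set T}) : rel T :=
  fun u v => (u \in A) != (v \in A).

Section Cut.
Variables (T : finType) (A : {set T}).

Lemma cut_adj_sym : symmetric (cut_adj A).
Proof. by move=> u v; rewrite /cut_adj eq_sym. Qed.

Lemma cut_adj_irr : irreflexive (cut_adj A).
Proof. by move=> u; rewrite /cut_adj eqxx. Qed.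

Definition cut_graph : sgraph T := SGraph cut_adj_sym cut_adj_irr.

Lemma degree_cut w : degree cut_graph w = if w \in A then #|~: A| else #|A|.
Proof.
case: ifP => Aw; apply: eq_card => v; rewrite !inE /= /cut_adj Aw;
  by case: (v \in A).
Qed.

Lemma cut_factor (G : sgraph T) (a b : nat) : compl G =2 clique A ->
  a <= #|A| <= b -> a <= #|~: A| <= b -> is_factor a b cut_graph G.
Proof.
move=> complG card_A card_CA; split=> [u v /= cut_uv|w]; last first.
  by rewrite degree_cut; case: ifP.
have := complG u v; rewrite complE /= /clique_adj.
case: eqVneq cut_uv => [->|_]; first by rewrite /cut_adj eqxx.
by rewrite /cut_adj; case: (u \in A); case: (v \in A) => //= _ /negbFE.
Qed.

End Cut.

Lemma color_bijection (T U : finType) (f : T -> nat) (g : U -> nat) (u0 : U) :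
  (forall c, #|[set x | f x == c]| = #|[set u | g u == c]|) ->
  exists2 phi : T -> U, bijective phi & forall x, g (phi x) = f x.
Proof.
move=> eq_card_color.
pose s := sort (relpre f leq) (enum T); pose t := sort (relpre g leq) (enum U).
have count_color (V : finType) (h : V -> nat) (c : nat) :
    count_mem c (map h (enum V)) = #|[set v | h v == c]|.
  by rewrite count_map cardsE cardE -size_filter enumT.
have eq_map : map f s = map g t.
  apply: (sorted_eq leq_trans anti_leq).
  - by rewrite sorted_map sort_sorted // => x y; apply: leq_total.
  - by rewrite sorted_map sort_sorted // => x y; apply: leq_total.
  rewrite (perm_trans (perm_map f (permEl (perm_sort _ _)))) // perm_sym.
  rewrite (perm_trans (perm_map g (permEl (perm_sort _ _)))) // perm_sym.
  by apply/allP => c _ /=; rewrite !count_color eq_card_color.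
have size_st : size s = size t by rewrite -(size_map f) eq_map size_map.
have card_TU : #|T| = #|U| by move: size_st; rewrite !size_sort -!cardE.
have mem_s x : x \in s by rewrite mem_sort mem_enum.
have lt_index x : index x s < size t by rewrite -size_st index_mem.
exists (fun x => nth u0 t (index x s)) => [|x].
  apply: inj_card_bij => [x y /eqP|]; last by rewrite card_TU.
  rewrite nth_uniq ?sort_uniq ?enum_uniq // => /eqP eq_index.
  by rewrite -(nth_index x (mem_s x)) eq_index nth_index.
rewrite -(nth_map u0 (f x)) // -eq_map (nth_map x) ?nth_index //.
by rewrite index_mem.
Qed.

Lemma isomorphic_of_coloring (T U : finType) (G : sgraph T) (K : sgraph U)
    (f : T -> nat) (g : U -> nat) (color_adj : rel nat) (u0 : U) :
  (forall c, #|[set x | f x == c]| = #|[set u | g u == c]|) ->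
  (forall x y, G x y = (x != y) && color_adj (f x) (f y)) ->
  (forall x y, K x y = (x != y) && color_adj (g x) (g y)) -> isomorphic G K.
Proof.
move=> /(color_bijection u0)[phi bij_phi phiE] GE KE; exists phi => // x y.
by rewrite KE GE !phiE (bij_eq bij_phi).
Qed.

Lemma card_set_sumType (T U : finType) (P : pred (T + U)) :
  #|[set p | P p]| = #|[set x | P (inl x)]| + #|[set y | P (inr y)]|.
Proof.
rewrite -!sum_mem_card big_sumType.
by congr (_ + _); apply: eq_bigr => i _; rewrite !inE.
Qed.

Lemma card_set_const (T : finType) (b : bool) : #|[set x : T | b]| = b * #|T|.
Proof.
case: b; rewrite ?mul1n ?mul0n ?cards0 //.
by apply: eq_card => x; rewrite inE.
Qed.

(* [disjoint_union] and [join] are convertible to the two values of [cross]. *)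
Definition sum_graph (cross : bool) (T U : finType) (G : sgraph T)
    (K : sgraph U) : sgraph (T + U)%type :=
  SGraph (@sum_adj_sym cross T U G K) (@sum_adj_irr cross T U G K).

Lemma card_edges_sum (cross : bool) (T U : finType) (G : sgraph T)
    (K : sgraph U) :
  #|edges (sum_graph cross G K)| =
  #|edges G| + #|edges K| + cross * (#|T| * #|U|).
Proof.
apply: card_edges_of_sum_degree; rewrite !mulnDr -!sum_degree big_sumType /=.
under eq_bigr do rewrite degreeE big_sumType /= -degreeE sum_nat_const.
under [X in _ + X]eq_bigr do
  rewrite degreeE big_sumType /= -degreeE sum_nat_const.
by rewrite !big_split /= !sum_nat_const -[#|xpredT|]/#|T| -[#|_|]/#|U|; lia.
Qed.

Lemma card_edges_isomorphic (T U : finType) (G : sgraph T) (K : sgraph U) :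
  isomorphic G K -> #|edges G| = #|edges K|.
Proof.
case=> phi bij_phi phiE; have bij_on := onW_bij predT bij_phi.
apply: card_edges_of_sum_degree; rewrite -sum_degree.
rewrite [RHS](reindex phi) //=; apply: eq_bigr => x _.
by rewrite !degreeE [RHS](reindex phi) //=; apply: eq_bigr => y _; rewrite phiE.
Qed.

Lemma card_edges_complete (m : nat) : #|edges (complete m)| = 'C(m, 2).
Proof. by rewrite -[in RHS](card_ord m) -card_edges_full. Qed.

Lemma card_edges_edgeless (m : nat) : #|edges (edgeless m)| = 0.
Proof.
apply: card_edges_of_sum_degree.
by rewrite big1 // => x _; rewrite degreeE big1.
Qed.

Lemma bin2D (p q : nat) : 'C(p + q, 2) = 'C(p, 2) + 'C(q, 2) + p * q.
Proof.
elim: p => [|p IH]; first by rewrite bin0n mul0n addn0.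
by rewrite addSn !binS IH !bin1; lia.
Qed.

Lemma card_edges_extremal (n a : nat) : 0 < a -> a < n ->
  #|edges (extremal_graph n a)| = 'C(n - 1, 2) + (a - 1).
Proof.
move=> a_gt0 lt_an; rewrite (_ : n - 1 = a - 1 + (n - a)); last by lia.
rewrite bin2D [LHS]card_edges_sum (card_edges_sum false) !card_edges_complete.
by rewrite card_sum !card_ord mul1n mulnDr muln1 (@bin_small 1 2) //; lia.
Qed.

Lemma extremal_isomorphic (T : finType) (G : sgraph T) (a : nat) (x : T) :
  0 < a -> a < #|T| -> degree (compl G) x = #|T| - a ->
  star_at (compl G) x =2 compl G -> isomorphic G (extremal_graph #|T| a).
Proof.
move=> a_gt0 lt_a; have GE u v : G u v = (u != v) && ~~ compl G u v.
  by rewrite complE; case: eqVneq => [->|_]; rewrite ?adj_irr ?negbK.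
move: (compl G) GE => H GE deg_x star.
pose f u := if u == x then 2 else (H x u : nat).
pose g (p : 'I_(a - 1) + ('I_(#|T| - a) + 'I_1)) :=
  match p with inl _ => 0 | inr (inl _) => 1 | inr (inr _) => 2 end.
pose color_adj c d := ~~ ((c == 1) && (d == 2) || (c == 2) && (d == 1)).
apply: (@isomorphic_of_coloring _ _ _ _ f g color_adj (inr (inr ord0))).
- have card2 : #|[set u | f u == 2]| = 1.
    rewrite -[RHS](cards1 x); apply: eq_card => u; rewrite !inE /f.
    by case: (u == x); case: (H x u).
  have card1 : #|[set u | f u == 1]| = #|T| - a.
    rewrite -deg_x; apply: eq_card => u; rewrite !inE /f.
    by have [->|_] := eqVneq u x; rewrite ?adj_irr //; case: (H x u).
  have card0 : #|[set u | f u == 0]| = a - 1.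
    have -> : [set u | f u == 0] = ~: (x |: [set u | H x u]).
      by apply/setP => u; rewrite !inE /f; case: (u == x); case: (H x u).
    rewrite cardsCs setCK cardsU1 inE adj_irr.
    by rewrite -[#|[set u | H x u]|]/(degree H x) deg_x; lia.
  move=> c; rewrite [RHS]card_set_sumType [X in _ + X]card_set_sumType.
  rewrite !card_set_const !card_ord.
  case: c => [|[|[|c]]]; rewrite ?card0 ?card1 ?card2 /=; try lia.
  rewrite (_ : [set _ | _] = set0) ?cards0 //; apply/setP => u; rewrite !inE /f.
  by case: (u == x); case: (H x u).
- move=> u v; rewrite GE /color_adj /f -(star u v) /= /star_adj.
  congr (_ && ~~ _); have [->|nux] := eqVneq u x; have [->|nvx] := eqVneq v x;
    rewrite ?adj_irr ?andbT ?andbF //=.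
  + by case: (H x v).
  + by rewrite adj_sym; case: (H x u).
  + by case: (H x u); case: (H x v).
- by move=> [u|[u|u]] [v|[v|v]]; rewrite /= /color_adj ?andbT ?ord1.
Qed.

Lemma join_edgeless_isomorphic (T : finType) (G : sgraph T) (S : {set T})
    (m s : nat) :
  compl G =2 clique S -> #|S| = s -> #|T| = m + s -> 0 < m ->
  isomorphic G (join (complete m) (edgeless s)).
Proof.
move=> complG card_S card_T m_gt0.
pose f u : nat := u \in S.
pose g (p : 'I_m + 'I_s) := if p is inr _ then 1 else 0.
pose color_adj c d := ~~ ((c == 1) && (d == 1)).
apply: (@isomorphic_of_coloring _ _ _ _ f g color_adj (inl (Ordinal m_gt0))).
- have card1 : #|[set u | f u == 1]| = s.
    by rewrite -card_S; apply: eq_card => u; rewrite !inE eqb1.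
  have card0 : #|[set u | f u == 0]| = m.
    have -> : [set u | f u == 0] = ~: S by apply/setP => u; rewrite !inE eqb0.
    by rewrite cardsCs setCK card_T card_S addnK.
  move=> c; rewrite [RHS]card_set_sumType !card_set_const !card_ord.
  case: c => [|[|c]]; rewrite ?card0 ?card1 /=; try lia.
  rewrite (_ : [set _ | _] = set0) ?cards0 //; apply/setP => u.
  by rewrite !inE /f; case: (u \in S).
- move=> u v; have := complG u v; rewrite complE /= /clique_adj /color_adj.
  rewrite /f; case: eqVneq => [->|_]; rewrite ?adj_irr // andbT !eqb1 => <-.
  by rewrite negbK.
- by move=> [i|i] [j|j]; rewrite /= /color_adj ?andbT ?andbF.
Qed.

Lemma card_edges_join_edgeless (m s : nat) :
  #|edges (join (complete m) (edgeless s))| = 'C(m, 2) + m * s.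
Proof.
rewrite (card_edges_sum true) card_edges_complete card_edges_edgeless.
by rewrite !card_ord addn0 mul1n.
Qed.

Lemma isomorphic_claw (T : finType) (G : sgraph T) :
  isomorphic G (join (complete 1) (edgeless 3)) <->
  isomorphic G (complete_bipartite 1 3).
Proof.
have same_adj p q :
    join (complete 1) (edgeless 3) p q = complete_bipartite 1 3 p q.
  by case: p q => [i|i] [j|j] //=; rewrite !ord1.
by split=> -[phi bij_phi phiE]; exists phi => // x y; rewrite -phiE same_adj.
Qed.

Lemma few_nonedges_no_factor (T : finType) (G : sgraph T) (a b : nat) :
  0 < a -> a <= b -> a < #|T| -> (a = b -> #|T| * a = 0 %[mod 2]) ->
  ~ (exists F, is_factor a b F G) -> #|edges (compl G)| <= #|T| - a ->
  #|edges (compl G)| = #|T| - a /\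
  (isomorphic G (extremal_graph #|T| a) \/
   [/\ a = 1 \/ a = 2, b < 3 & isomorphic G (join (complete a) (edgeless 3))]).
Proof.
move=> a_gt0 le_ab lt_aT parity no_factor few.
have [/forallP deg_lt|/forallPn[x]] :=
    boolP [forall w, degree (compl G) w < #|T| - a]; last first.
  rewrite -leqNgt => ge_x; have le_x := degree_le_edges (compl G) x.
  have [deg_x eq_edges] : degree (compl G) x = #|T| - a /\
      #|edges (compl G)| = #|T| - a by lia.
  split=> //; left; apply: (extremal_isomorphic a_gt0 lt_aT deg_x).
  by apply: star_of_degree; rewrite eq_edges deg_x.
have [|[F sF reg]|[a12 n_eq [S card_S clique_S]]] :=
    near_regular_or_clique a_gt0 _ deg_lt few; first by lia.
  case: no_factor; exists F; apply: near_regular_factor reg => //.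
  by move=> u v /sF/compl_compl_sub.
have card_T : #|T| = a + 3 by lia.
have card_CS : #|~: S| = a by rewrite cardsCs setCK card_T card_S addnK.
split.
  by rewrite (eq_card_edges clique_S) card_edges_clique card_S n_eq.
right; split=> //; last first.
  exact: join_edgeless_isomorphic clique_S card_S card_T a_gt0.
rewrite ltnNge; apply/negP => b_ge3; apply: no_factor; exists (cut_graph S).
by apply: cut_factor clique_S _ _; rewrite ?card_S ?card_CS; lia.
Qed.

Lemma no_factor_card_edges (T : finType) (G : sgraph T) (a b : nat) :
  0 < a -> a <= b -> a < #|T| -> (a = b -> #|T| * a = 0 %[mod 2]) ->
  ~ (exists F, is_factor a b F G) ->
  #|edges G| <= 'C(#|T| - 1, 2) + (a - 1) /\
  (#|edges G| = 'C(#|T| - 1, 2) + (a - 1) <->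
    isomorphic G (extremal_graph #|T| a) \/
    [/\ a = 1 \/ a = 2, b < 3 & isomorphic G (join (complete a) (edgeless 3))]).
Proof.
move=> a_gt0 le_ab lt_aT parity no_factor.
have structure := few_nonedges_no_factor a_gt0 le_ab lt_aT parity no_factor.
have edgesG : #|edges (compl G)| + #|edges G| = 'C(#|T| - 1, 2) + (#|T| - 1).
  rewrite card_edges_compl.
  by case: #|T| lt_aT => // m _; rewrite binS bin1 subn1.
split; first by have := structure; lia.
split=> [edges_eq|[ext|[a12 _ iso]]]; first by have [|] := structure; [lia |].
  by rewrite (card_edges_isomorphic ext) card_edges_extremal.
have [phi /bij_eq_card -> _] := iso.
rewrite (card_edges_isomorphic iso) card_edges_join_edgeless card_sum !card_ord.
by case: a12 => ->.
Qed.

Theorem theorem1p1 (a b n : nat) (T : finType) (G : sgraph T)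
    (a_gt0 : 0 < a) (le_ab : a <= b) (order_G : #|T| = n) (n_ge : a + 1 <= n)
    (parity : a = b -> n * a = 0 %[mod 2])
    (no_factor : ~ exists F : sgraph T, is_factor a b F G) :
  #|edges G| <= 'C(n - 1, 2) + (a - 1) /\
  (#|edges G| = 'C(n - 1, 2) + (a - 1) <->
    [\/ (a * b = 1 \/ a * b = 2) /\
        (isomorphic G (extremal_graph n a) \/
         isomorphic G (complete_bipartite 1 3)),
        (a = 2 /\ b = 2) /\
        (isomorphic G (extremal_graph n a) \/
         isomorphic G (join (complete 2) (edgeless 3))) |
        3 <= b /\ isomorphic G (extremal_graph n a)]).
Proof.
subst n; rewrite addn1 in n_ge.
have [le_edges edges_eq] :=
  no_factor_card_edges a_gt0 le_ab n_ge parity no_factor.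
split=> //; split=> [/edges_eq[ext|[a12 b_lt3 join_iso]]|].
- have [ab|[ab|b_ge3]] : (a * b = 1 \/ a * b = 2) \/ a = 2 /\ b = 2 \/ 3 <= b.
    by nia.
  + by constructor 1; split=> //; left.
  + by constructor 2; split=> //; left.
  + by constructor 3.
- case: a12 => a_eq; subst a.
  + by constructor 1; split; [lia | right; apply/isomorphic_claw].
  + by constructor 2; split; [lia | right].
- case=> [[ab [ext|/isomorphic_claw claw]]|[[a2 b2] [ext|join_iso]]|[_ ext]];
    apply/edges_eq; try by left.
  + have [a1 b_lt3] : a = 1 /\ b < 3 by nia.
    by right; subst a; split=> //; left.
  + by right; subst a b; split=> //; right.
Qed.
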